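(* Let $\pi$ be a group with cohomological dimension $\operatorname{cd}\pi=n$, where $n$ is a nonnegative integer. Then the $n$-th cup power $\mathfrak b^{n}\in H^n(\pi;I(\pi)^{\otimes n})$ of the Berstein class $\mathfrak b=\mathfrak b_\pi\in H^1(\pi;I(\pi))$ is nonzero.
   Context: For a group $\pi$, $\mathbb Z[\pi]$ is the integral group ring, $\varepsilon:\mathbb Z[\pi]\to\mathbb Z$ is the augmentation, and $I(\pi)=\ker\varepsilon$ is the augmentation ideal. $\operatorname{cd}\pi$ is the cohomological dimension of $\pi$ (over $\mathbb Z$). Tensor products are taken over $\mathbb Z$ with the diagonal $\pi$-action. The Berstein class of a connected pointed CW complex $(X,x_0)$ with $\pi=\pi_1(X,x_0)$: let $p:\widetilde X\to X$ be the universal covering and $\widetilde X_0=p^{-1}(x_0)$. The exact sequence $0\to H_1(\widetilde X,\widetilde X_0)\to H_0(\widetilde X_0)\to H_0(\widetilde X)$ gives an isomorphism $H_1(\widetilde X,\widetilde X_0)\cong I(\pi)$, hence $H^1(X,x_0;I(\pi))\cong\operatorname{Hom}_{\mathbb Z[\pi]}(H_1(\widetilde X,\widetilde X_0),I(\pi))\cong\operatorname{Hom}_{\mathbb Z[\pi]}(I(\pi),I(\pi))$. Let $\overline{\mathfrak b}\in H^1(X,x_0;I(\pi))$ correspond to the identity $1_{I(\pi)}$, and put $\mathfrak b_X=j^*\overline{\mathfrak b}\in H^1(X;I(\pi))$ where $j:(X,\emptyset)\to(X,x_0)$ is the inclusion. The Berstein class of the group is $\mathfrak b_\pi=\mathfrak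 b_{K(\pi,1)}\in H^1(\pi;I(\pi))$. The cup power $\mathfrak b^n$ lies in $H^n$ with coefficients in the $n$-fold tensor power $I(\pi)\otimes\cdots\otimes I(\pi)$; by convention $\mathfrak b^0=1\in H^0(\pi;\mathbb Z)$. *)

(* Defs.v *)
From HB Require Import structures.
From mathcomp Require Import all_boot all_order all_algebra.
From mathcomp Require Import boolp functions.
From mathcomp Require Import freeg.

Set Implicit Arguments.
Unset Strict Implicit.
Unset Printing Implicit Defensive.

Import GRing.Theory.
Local Open Scope ring_scope.
Local Open Scope quotient_scope.

(* Left Z[G]-modules, given as abelian groups with an additive action of G. *)
Record gmodule (G : groupType) := GModule {
  gmod_sort :> zmodType;
  gact : G -> gmod_sort -> gmod_sort;
  gact_zmod : forall g, zmod_morphism (gact g);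
  gact1 : forall m, gact 1%g m = m;
  gactM : forall g h m, gact (g * h)%g m = gact g (gact h m) }.

Record ghom (G : groupType) (M N : gmodule G) := GHom {
  ghom_fun :> M -> N;
  ghom_zmod : zmod_morphism ghom_fun;
  ghom_act : forall g m, ghom_fun (gact g m) = gact g (ghom_fun m) }.

Section GModuleTheory.
Variable G : groupType.

Section Act.
Variables (M : gmodule G) (g : G).
HB.instance Definition _ :=
  GRing.isZmodMorphism.Build M M (gact g) (@gact_zmod G M g).
End Act.

Section Hom.
Variables (M N : gmodule G) (f : ghom M N).
HB.instance Definition _ :=
  GRing.isZmodMorphism.Build M N (ghom_fun f) (@ghom_zmod G M N f).
End Hom.

Lemma ghom_id_zmod (M : gmodule G) : zmod_morphism (@id M).
Proof. by []. Qed.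

Definition ghom_id (M : gmodule G) : ghom M M :=
  GHom (@ghom_id_zmod M) (fun _ _ => erefl).

Lemma triv_zmod : zmod_morphism (@id int).
Proof. by []. Qed.

Definition trivZ : gmodule G :=
  @GModule G int (fun _ k => k) (fun _ => triv_zmod)
    (fun _ => erefl) (fun _ _ _ => erefl).

End GModuleTheory.

Arguments trivZ G : clear implicits.
Arguments ghom_id {G} M.

Definition projective (G : groupType) (P : gmodule G) : Prop :=
  forall (M N : gmodule G) (p : ghom M N) (f : ghom P N),
    (forall y, exists x, p x = y) -> exists h : ghom P M, forall x, p (h x) = f x.

Record proj_resolution (G : groupType) (M : gmodule G) (n : nat) := ProjRes {
  res_obj : nat -> gmodule G;
  res_d : forall i, ghom (res_obj i.+1) (res_obj i);
  res_aug : ghom (res_obj 0%N) M;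
  res_proj : forall i, projective (res_obj i);
  res_aug_surj : forall y, exists x, res_aug x = y;
  res_exact0 : forall x, res_aug x = 0 <-> exists y, res_d 0%N y = x;
  res_exact : forall i x, res_d i x = 0 <-> exists y, res_d i.+1 y = x;
  res_len : forall i, (n < i)%N -> forall x : res_obj i, x = 0 }.

(* The cohomological dimension over Z is the projective dimension of Z over Z[G]. *)
Definition cd_eq (G : groupType) (n : nat) : Prop :=
  inhabited (proj_resolution (trivZ G) n) /\
  forall m, (m < n)%N -> ~ inhabited (proj_resolution (trivZ G) m).

Section FreegLift.
Variables (K : choiceType) (A : zmodType) (f : K -> A).

Definition fgext (x : {freeg K}) : A :=
  @fglift int (zmodule A) K (f : K -> zmodule A) x.

Lemma fgext_zmod : zmod_morphism fgext.
Proof. exact: (@lift_is_additive int K (zmodule A) f). Qed.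

HB.instance Definition _ :=
  GRing.isZmodMorphism.Build {freeg K} A fgext fgext_zmod.

Lemma fgextU k : fgext <<k>> = f k.
Proof. by rewrite /fgext liftU scale1r. Qed.

End FreegLift.

Lemma freeg_morph_eq (K : choiceType) (A : zmodType)
    (u v : {additive {freeg K} -> A}) :
  (forall k, u <<k>> = v <<k>>) -> u =1 v.
Proof.
move=> e x; rewrite -[x]freeg_sumE !raddf_sum; apply: eq_bigr => k _.
by rewrite -[coeff k x]intz -freegU_mulz !raddfMz e.
Qed.

Section Generated.
Variables (V : zmodType) (P : V -> Prop).

Inductive generated : V -> Prop :=
| gen_in x of P x : generated x
| gen0 : generated 0
| genB x y of generated x & generated y : generated (x - y).

Definition gen_pred : {pred V} := fun x => `[< generated x >].

Lemma gen_pred_closed : zmod_closed gen_pred.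
Proof.
split=> [|x y]; first by apply/asboolP; exact: gen0.
by move=> /asboolP gx /asboolP gy; apply/asboolP; exact: genB.
Qed.

HB.instance Definition _ := GRing.isZmodClosed.Build V gen_pred gen_pred_closed.

End Generated.

Lemma zmod_morphD (A B : zmodType) (f : A -> B) :
  zmod_morphism f -> {morph f : x y / x + y}.
Proof.
move=> fB; pose u : {additive A -> B} :=
  HB.pack f (GRing.isZmodMorphism.Build A B f fB).
exact: (raddfD u).
Qed.

Section Tensor.
Variables M N : zmodType.

Variant tens_rel : {freeg (M * N)%type} -> Prop :=
| tens_relDl a b n : tens_rel (<<(a + b, n)>> - <<(a, n)>> - <<(b, n)>>)
| tens_relDr m a b : tens_rel (<<(m, a + b)>> - <<(m, a)>> - <<(m, b)>>).

Definition tensor := Quotient.quot (gen_pred tens_rel).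
HB.instance Definition _ := GRing.Zmodule.on tensor.

Definition tpi (x : {freeg (M * N)%type}) : tensor :=
  \pi_(Quotient.quot (gen_pred tens_rel)) x.

Lemma tpi_zmod : zmod_morphism tpi.
Proof. by move=> x y; rewrite /tpi raddfB. Qed.

HB.instance Definition _ :=
  GRing.isZmodMorphism.Build {freeg (M * N)%type} tensor tpi tpi_zmod.

Definition tens (m : M) (n : N) : tensor := tpi <<(m, n)>>.

Lemma tpi_eq x y : generated tens_rel (x - y) -> tpi x = tpi y.
Proof.
move=> h; apply/eqP; rewrite /tpi -Quotient.idealrBE; exact/asboolP.
Qed.

Lemma tpi_eqP x y : tpi x = tpi y -> generated tens_rel (x - y).
Proof.
by move/eqP; rewrite /tpi -Quotient.idealrBE => /asboolP.
Qed.

Lemma tensDl a b n : tens (a + b) n = tens a n + tens b n.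
Proof.
rewrite /tens -raddfD; apply: tpi_eq; rewrite opprD addrA.
exact: (gen_in (tens_relDl a b n)).
Qed.

Lemma tensDr m a b : tens m (a + b) = tens m a + tens m b.
Proof.
rewrite /tens -raddfD; apply: tpi_eq; rewrite opprD addrA.
exact: (gen_in (tens_relDr m a b)).
Qed.

Lemma tensBl n : zmod_morphism (tens^~ n).
Proof.
move=> a b /=; apply: (@addIr _ (tens b n)).
by rewrite -tensDl !subrK.
Qed.

Lemma tensBr m : zmod_morphism (tens m).
Proof.
move=> a b /=; apply: (@addIr _ (tens m b)).
by rewrite -tensDr !subrK.
Qed.

HB.instance Definition _ m :=
  GRing.isZmodMorphism.Build N tensor (tens m) (tensBr m).

Lemma tens_suml I (r : seq I) (F : I -> M) n :
  tens (\sum_(i <- r) F i) n = \sum_(i <- r) tens (F i) n.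
Proof.
pose u : {additive M -> tensor} :=
  HB.pack (tens^~ n) (GRing.isZmodMorphism.Build M tensor (tens^~ n) (tensBl n)).
exact: (raddf_sum u).
Qed.

Lemma tensMzl m n k : tens (m *~ k) n = tens m n *~ k.
Proof.
pose u : {additive M -> tensor} :=
  HB.pack (tens^~ n) (GRing.isZmodMorphism.Build M tensor (tens^~ n) (tensBl n)).
exact: (raddfMz u).
Qed.

Lemma tens0l n : tens 0 n = 0.
Proof. by have := tensBl n 0 0; rewrite !subrr. Qed.

Section Lift.
Variables (A : zmodType) (b : M -> N -> A).
Hypothesis bl : forall n, zmod_morphism (b^~ n).
Hypothesis br : forall m, zmod_morphism (b m).

Definition tens_lift (t : tensor) : A :=
  fgext (fun p : M * N => b p.1 p.2) (repr t).

Lemma tens_lift_pi x : tens_lift (tpi x) = fgext (fun p : M * N => b p.1 p.2) x.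
Proof.
rewrite /tens_lift; apply/eqP; rewrite -subr_eq0 -raddfB; apply/eqP.
have: generated tens_rel (repr (tpi x) - x).
  by apply: tpi_eqP; rewrite /tpi reprK.
elim=> [y|| y z _ ey _ ez]; last by rewrite raddfB ey ez subrr.
  case=> [a c n|m a c]; rewrite !raddfB /= !fgextU /=.
    by rewrite (zmod_morphD (bl n)) addrAC addrK subrr.
  by rewrite (zmod_morphD (br m)) addrAC addrK subrr.
by rewrite raddf0.
Qed.

Lemma tens_liftE m n : tens_lift (tens m n) = b m n.
Proof. by rewrite tens_lift_pi /= fgextU. Qed.

Lemma tens_lift_zmod : zmod_morphism tens_lift.
Proof.
move=> x y; rewrite -[x]reprK -[y]reprK -/(tpi _) -/(tpi (repr y)).
by rewrite -raddfB !tens_lift_pi raddfB.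
Qed.

End Lift.

Lemma tens_morph_eq (A : zmodType) (u v : tensor -> A) :
  zmod_morphism u -> zmod_morphism v ->
  (forall m n, u (tens m n) = v (tens m n)) -> u =1 v.
Proof.
move=> uB vB e t; rewrite -[t]reprK -/(tpi _).
pose u' : {additive tensor -> A} :=
  HB.pack u (GRing.isZmodMorphism.Build tensor A u uB).
pose v' : {additive tensor -> A} :=
  HB.pack v (GRing.isZmodMorphism.Build tensor A v vB).
exact: (@freeg_morph_eq _ _ (u' \o tpi)%FUN (v' \o tpi)%FUN (fun k =>
  let: (m, n) := k in e m n)).
Qed.

End Tensor.

Section GTensor.
Variables (G : groupType) (M N : gmodule G).

Definition tens_act (g : G) : tensor M N -> tensor M N :=
  tens_lift (fun m n => tens (gact g m) (gact g n)).

Lemma tens_act_l g (n : N) :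
  zmod_morphism (fun m : M => tens (gact g m) (gact g n)).
Proof. by move=> a b; rewrite raddfB tensBl. Qed.

Lemma tens_act_r g (m : M) :
  zmod_morphism (fun n : N => tens (gact g m) (gact g n)).
Proof. by move=> a b; rewrite !raddfB. Qed.

Lemma tens_actE g m n : tens_act g (tens m n) = tens (gact g m) (gact g n).
Proof. by rewrite /tens_act tens_liftE; [|exact: tens_act_l|exact: tens_act_r]. Qed.

Lemma tens_act_zmod g : zmod_morphism (tens_act g).
Proof. by apply: tens_lift_zmod; [exact: tens_act_l|exact: tens_act_r]. Qed.

Lemma tens_act1 t : tens_act 1%g t = t.
Proof.
apply: (tens_morph_eq (tens_act_zmod _) (v := id)) => // m n.
by rewrite tens_actE !gact1.
Qed.

Lemma tens_actM g h t : tens_act (g * h)%g t = tens_act g (tens_act h t).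
Proof.
apply: (tens_morph_eq (tens_act_zmod _) (v := tens_act g \o tens_act h)).
  by move=> x y /=; rewrite !tens_act_zmod.
by move=> m n; rewrite /= !tens_actE !gactM.
Qed.

(* the tensor product over Z, with the diagonal action *)
Definition gtensor : gmodule G := GModule tens_act_zmod tens_act1 tens_actM.

End GTensor.

Fixpoint tpow (G : groupType) (M : gmodule G) (n : nat) : gmodule G :=
  match n with
  | 0 => trivZ G
  | k.+1 => match k with 0 => M | _.+1 => gtensor M (tpow M k) end
  end.

Section Augmentation.
Variable G : groupType.

(* [{freeg G}] is the underlying abelian group of Z[G] and [deg] (the sum of the
   coefficients) is its augmentation. *)
Definition augI_pred : {pred {freeg G}} := fun x => deg x == 0.

Lemma augI_closed : zmod_closed augI_pred.
Proof.
split=> [|x y]; rewrite !unfold_in ?raddf0 // => /eqP dx /eqP dy.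
by rewrite raddfB /= dx dy subrr.
Qed.

HB.instance Definition _ :=
  GRing.isZmodClosed.Build {freeg G} augI_pred augI_closed.

Record augI_sub := AugI { augI_val : {freeg G}; augI_valP : augI_val \in augI_pred }.

HB.instance Definition _ := [isSub for augI_val].
HB.instance Definition _ := [Choice of augI_sub by <:].
HB.instance Definition _ := [SubChoice_isSubZmodule of augI_sub by <:].

Definition ltrans (g : G) (x : {freeg G}) : {freeg G} :=
  fgext (fun h => <<(g * h)%g>>) x.

Lemma ltrans_zmod g : zmod_morphism (ltrans g).
Proof. exact: fgext_zmod. Qed.

HB.instance Definition _ g :=
  GRing.isZmodMorphism.Build {freeg G} {freeg G} (ltrans g) (ltrans_zmod g).

Lemma ltransU g h : ltrans g <<h>> = <<(g * h)%g>>.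
Proof. exact: fgextU. Qed.

Lemma deg_ltrans g x : deg (ltrans g x) = deg x.
Proof.
apply: (@freeg_morph_eq _ _ (@deg G \o ltrans g)%FUN (@deg G) _ x) => h.
by rewrite /= ltransU !degU.
Qed.

Lemma ltrans1 x : ltrans 1%g x = x.
Proof.
apply: (@freeg_morph_eq _ _ (ltrans 1%g) idfun) => h.
by rewrite /= ltransU mul1g.
Qed.

Lemma ltransM g h x : ltrans (g * h)%g x = ltrans g (ltrans h x).
Proof.
apply: (@freeg_morph_eq _ _ (ltrans (g * h)%g) (ltrans g \o ltrans h)%FUN) => k /=.
by rewrite !ltransU mulgA.
Qed.

Definition zgroup_ring : gmodule G := GModule ltrans_zmod ltrans1 ltransM.

Lemma augI_act_subproof g (x : augI_sub) : ltrans g (val x) \in augI_pred.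
Proof. by rewrite unfold_in deg_ltrans; exact: (valP x). Qed.

Definition augI_act g (x : augI_sub) : augI_sub := AugI (augI_act_subproof g x).

Lemma augI_act_zmod g : zmod_morphism (augI_act g).
Proof. by move=> x y; apply: val_inj; rewrite /= raddfB. Qed.

Lemma augI_act1 x : augI_act 1%g x = x.
Proof. by apply: val_inj; rewrite /= ltrans1. Qed.

Lemma augI_actM g h x : augI_act (g * h)%g x = augI_act g (augI_act h x).
Proof. by apply: val_inj; rewrite /= ltransM. Qed.

Definition augI : gmodule G := GModule augI_act_zmod augI_act1 augI_actM.

End Augmentation.

Section Cochains.
Variable G : groupType.

Definition cochain (n : nat) (M : gmodule G) := ('I_n.+1 -> G) -> M.

Definition equivariant n (M : gmodule G) (f : cochain n M) : Prop :=
  forall (g : G) x, f (fun i => (g * x i)%g) = gact g (f x).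

Definition cobdry n (M : gmodule G) (f : cochain n M) : cochain n.+1 M :=
  fun x => \sum_(i < n.+2) f (fun j => x (fintype.lift i j)) *~ (-1) ^+ i.

Definition is_cocycle n (M : gmodule G) (f : cochain n M) : Prop :=
  equivariant f /\ cobdry f =1 fun=> 0.

Definition is_cobdry n (M : gmodule G) : cochain n M -> Prop :=
  match n with
  | 0 => fun f => f =1 fun=> 0
  | _.+1 => fun f => exists h : cochain _ M, equivariant h /\ cobdry h =1 f
  end.

End Cochains.

Section Cohomology.
Variables (G : groupType) (n : nat) (M : gmodule G).

Lemma cobdryB (f g : cochain n M) x :
  cobdry (fun y => f y - g y) x = cobdry f x - cobdry g x.
Proof. by rewrite /cobdry -sumrB; apply: eq_bigr => i _; rewrite mulrzBl. Qed.

Definition cocycle_pred : {pred (('I_n.+1 -> G) -> M)} :=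
  fun f => `[< is_cocycle (f : cochain n M) >].

Lemma cocycle_pred_closed : zmod_closed cocycle_pred.
Proof.
split=> [|f g /asboolP[fe fz] /asboolP[ge gz]]; apply/asboolP; split.
- by move=> g x; rewrite raddf0.
- by move=> x; rewrite /cobdry big1 // => i _; rewrite mul0rz.
- move=> h x; change (f (fun i => (h * x i)%g) - g (fun i => (h * x i)%g) =
    gact h (f x - g x)).
  by rewrite raddfB /= fe ge.
- by move=> x; rewrite (cobdryB f g) fz gz subrr.
Qed.

HB.instance Definition _ :=
  GRing.isZmodClosed.Build (('I_n.+1 -> G) -> M) cocycle_pred cocycle_pred_closed.

Record cocycle := Cocycle {
  cocycle_val :> ('I_n.+1 -> G) -> M;
  cocycle_valP : cocycle_val \in cocycle_pred }.

HB.instance Definition _ := [isSub for cocycle_val].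
HB.instance Definition _ := [Choice of cocycle by <:].
HB.instance Definition _ := [SubChoice_isSubZmodule of cocycle by <:].

Lemma cocycleP (z : cocycle) : is_cocycle (z : cochain n M).
Proof. by have /asboolP := cocycle_valP z. Qed.

Definition mkcocycle (f : cochain n M) (h : is_cocycle f) : cocycle :=
  Cocycle (asboolT h).

Definition cobdry_pred : {pred cocycle} :=
  fun z => `[< is_cobdry (z : cochain n M) >].

End Cohomology.

Lemma cobdry_pred_closed (G : groupType) n (M : gmodule G) :
  zmod_closed (@cobdry_pred G n M).
Proof.
case: n => [|n].
  split=> [|x y /asboolP fx /asboolP fy]; apply/asboolP => //= t.
  by have /= := fx t; have /= := fy t => ey ex; rewrite [LHS](_ : _ = x t - y t) // ex ey subrr.
split=> [|x y /asboolP[f [fe fz]] /asboolP[g [ge gz]]]; apply/asboolP.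
  exists (fun=> 0); split=> [g x|x]; first by rewrite raddf0.
  by rewrite /cobdry big1 // => i _; rewrite mul0rz.
exists (fun t => f t - g t); split=> [h t|t]; first by rewrite raddfB /= fe ge.
by rewrite cobdryB fz gz.
Qed.

HB.instance Definition _ (G : groupType) n (M : gmodule G) :=
  GRing.isZmodClosed.Build (cocycle n M) (@cobdry_pred G n M)
    (@cobdry_pred_closed G n M).

(* H^n(G; M) is computed by the complex of homogeneous cochains, that is by the
   equivariant cochains on the universal cover EG of the standard simplicial
   K(G, 1), whose n-simplices are the (n+1)-tuples of elements of G. *)
Definition cohomology (G : groupType) (n : nat) (M : gmodule G) :=
  Quotient.quot (@cobdry_pred G n M).
HB.instance Definition _ (G : groupType) n (M : gmodule G) :=
  GRing.Zmodule.on (cohomology n M).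

Definition cclass (G : groupType) n (M : gmodule G) (z : cocycle n M) :
  cohomology n M := \pi_(Quotient.quot (@cobdry_pred G n M)) z.

Lemma cclass_zmod (G : groupType) n (M : gmodule G) :
  zmod_morphism (@cclass G n M).
Proof. by move=> x y; rewrite /cclass raddfB. Qed.

HB.instance Definition _ (G : groupType) n (M : gmodule G) :=
  GRing.isZmodMorphism.Build (cocycle n M) (cohomology n M) (@cclass G n M)
    (@cclass_zmod G n M).

Lemma cclass_eqP (G : groupType) n (M : gmodule G) (x y : cocycle n M) :
  cclass x = cclass y <-> is_cobdry ((x - y : cocycle n M) : cochain n M).
Proof.
split=> [/eqP|h].
  by rewrite /cclass -Quotient.idealrBE => /asboolP.
by apply/eqP; rewrite /cclass -Quotient.idealrBE; exact/asboolP.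
Qed.

Lemma cclass_eq0P (G : groupType) n (M : gmodule G) (x : cocycle n M) :
  cclass x = 0 <-> is_cobdry (x : cochain n M).
Proof. by rewrite -(raddf0 (@cclass G n M)) cclass_eqP subr0. Qed.

Section CupCochain.
Variables (G : groupType) (p q : nat) (M N : gmodule G).

(* Alexander-Whitney: (f u g)(x_0, .., x_(p+q)) = f(x_0, .., x_p) (x) g(x_p, .., x_(p+q)) *)
Definition cup_cochain (f : cochain p M) (g : cochain q N) :
    cochain (p + q) (gtensor M N) :=
  fun x => tens (f (fun i => x (inord i))) (g (fun j => x (inord (p + j)))).

Lemma cup_equivariant f g :
  equivariant f -> equivariant g -> equivariant (cup_cochain f g).
Proof. by move=> fe ge h x; rewrite /cup_cochain fe ge /= tens_actE. Qed.

End CupCochain.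

Section Leibniz.
Variable G : groupType.

(* Cochains evaluated on infinite sequences of vertices, to avoid casts. *)
Definition cext n (M : gmodule G) (f : cochain n M) (y : nat -> G) : M :=
  f (fun i : 'I_n.+1 => y i).

Definition cdN n (M : gmodule G) (f : cochain n M) (y : nat -> G) : M :=
  \sum_(0 <= i < n.+2) cext f (fun j => y (bump i j)) *~ (-1) ^+ i.

Lemma cext_eq n (M : gmodule G) (f : cochain n M) y z :
  (forall i, (i <= n)%N -> y i = z i) -> cext f y = cext f z.
Proof.
by move=> e; congr (f _); apply/funext => i; apply: e; rewrite -ltnS.
Qed.

Lemma cext_cobdry n (M : gmodule G) (f : cochain n M) y :
  cext (cobdry f) y = cdN f y.
Proof. by rewrite /cdN big_mkord. Qed.

Lemma cextK n (M : gmodule G) (f : cochain n M) x :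
  cext f (fun k => x (inord k)) = f x.
Proof. by congr (f _); apply/funext => i; rewrite inord_val. Qed.

Lemma cext_cup p q (M N : gmodule G) (f : cochain p M) (g : cochain q N) y :
  cext (cup_cochain f g) y = tens (cext f y) (cext g (fun j => y (p + j)%N)).
Proof.
rewrite /cext /cup_cochain; congr (tens (f _) (g _)); apply/funext => i.
  by rewrite inordK // ltnS (leq_trans _ (leq_addr _ _)) // -ltnS.
by rewrite inordK // ltnS leq_add2l -ltnS.
Qed.

Lemma cup_leibniz p q (M N : gmodule G) (f : cochain p M) (g : cochain q N) y :
  cdN (cup_cochain f g) y =
    tens (cdN f y) (cext g (fun j => y (p.+1 + j)%N)) +
    tens (cext f y) (cdN g (fun j => y (p + j)%N)) *~ (-1) ^+ p.
Proof.
have split_sum (F : nat -> gtensor M N) : \sum_(0 <= i < (p + q).+2) F i =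
    \sum_(0 <= i < p.+1) F i + \sum_(0 <= i < q.+1) F (i + p.+1)%N.
  rewrite (@big_cat_nat _ _ _ p.+1) //= ?ltnS ?leqW ?leq_addr //.
  by rewrite -{2}[p.+1]add0n big_addn -addnS -addSn addKn.
rewrite {1}/cdN split_sum {split_sum}.
rewrite {1}/cdN [\sum_(0 <= i < p.+2) _]big_nat_recr //=.
rewrite /cdN [\sum_(0 <= i < q.+2) _]big_nat_recl //=.
set A := \sum_(0 <= i < p.+1) _; set B := \sum_(0 <= i < q.+1) _.
set A' := \sum_(0 <= i < p.+1) _; set B' := \sum_(0 <= i < q.+1) _.
have -> : A = tens A' (cext g (fun j => y (p.+1 + j)%N)).
  rewrite tens_suml; apply: eq_big_nat => i /andP[_ ip].
  rewrite cext_cup tensMzl; congr (tens _ _ *~ _); apply: cext_eq => j _.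
  by rewrite /bump (leq_trans _ (leq_addr _ _)).
have -> : B = tens (cext f y) B' *~ (-1) ^+ p.
  rewrite raddf_sum mulrz_suml; apply: eq_big_nat => i _.
  rewrite (_ : (-1) ^+ (i + p.+1) = (-1) ^+ i.+1 * (-1) ^+ p :> int); last first.
    by rewrite -exprD addSnnS.
  rewrite cext_cup raddfMz -mulrzA; congr (tens _ _ *~ _); apply: cext_eq => j.
    by move=> jp; rewrite /bump leqNgt ltn_addl.
  by move=> _; rewrite /bump addnCA -addSnnS [(i.+1 + p)%N]addnC leq_add2l.
rewrite tensDl raddfD mulrzDl expr0 mulr1z -!addrA; congr (_ + _).
rewrite addrA -[LHS]add0r; congr (_ + _).
rewrite tensMzl exprS mulN1r mulrNz.
rewrite (_ : cext f _ = cext f y); last first.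
  by apply: cext_eq => j jp; rewrite /bump ltnNge jp.
rewrite [X in _ = _ + tens _ X *~ _](_ : _ = cext g (fun j => y (p.+1 + j)%N)) ?addNr //.
by apply: cext_eq => j _; rewrite /bump addnCA.
Qed.

Lemma is_cobdryI n m (M : gmodule G) (f : cochain n M) (h : cochain m M) :
  m.+1 = n -> equivariant h -> (forall y, cdN h y = cext f y) -> is_cobdry f.
Proof.
move=> e; case: n / e f => f he hf; exists h; split=> // x.
by rewrite -[RHS]cextK -hf -cext_cobdry cextK.
Qed.

Lemma is_cobdryE n (M : gmodule G) (f : cochain n M) : is_cobdry f ->
  (forall y, cext f y = 0) \/
  exists m (h : cochain m M), [/\ m.+1 = n, equivariant h &
    forall y, cdN h y = cext f y].
Proof.
case: n f => [|n] f /=; first by move=> f0; left => y; exact: f0.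
case=> h [he hf]; right; exists n, h; split=> // y.
by rewrite -cext_cobdry; exact: hf.
Qed.

Lemma is_cobdry0 n (M : gmodule G) (f : cochain n M) :
  (forall y, cext f y = 0) -> is_cobdry f.
Proof.
move=> f0; have f0' x : f x = 0 by rewrite -cextK f0.
case: n f {f0} f0' => [|n] f f0 //=; exists (fun=> 0); split=> [g x|x].
  by rewrite raddf0.
by rewrite f0 /cobdry big1 // => i _; rewrite mul0rz.
Qed.

Lemma cdN_cocycle n (M : gmodule G) (f : cocycle n M) y : cdN f y = 0.
Proof. by rewrite -cext_cobdry; case: (cocycleP f) => _; apply. Qed.

Lemma cext_cocycle n (M : gmodule G) (f : cochain n M) :
  equivariant f -> (forall y, cdN f y = 0) -> is_cocycle f.
Proof. by move=> fe fz; split=> // x; rewrite -cextK cext_cobdry fz. Qed.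

End Leibniz.

Section Cup.
Variables (G : groupType) (p q : nat) (M N : gmodule G).

Lemma cup_is_cocycle (f : cocycle p M) (g : cocycle q N) :
  is_cocycle (cup_cochain f g).
Proof.
apply: cext_cocycle => [|y].
  by apply: cup_equivariant; [case: (cocycleP f)|case: (cocycleP g)].
by rewrite cup_leibniz !cdN_cocycle tens0l raddf0 mul0rz addr0.
Qed.

Definition cup_cocycle (f : cocycle p M) (g : cocycle q N) :
  cocycle (p + q) (gtensor M N) := mkcocycle (cup_is_cocycle f g).

(* independent of the representatives by [cup_cclass] below *)
Definition cup (a : cohomology p M) (b : cohomology q N) :
    cohomology (p + q) (gtensor M N) :=
  cclass (cup_cocycle (repr a) (repr b)).

Lemma cup_cclass f g : cup (cclass f) (cclass g) = cclass (cup_cocycle f g).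
Proof.
rewrite /cup; set f' := repr _; set g' := repr _.
have /cclass_eqP/is_cobdryE ef : cclass f' = cclass f by rewrite /cclass reprK.
have /cclass_eqP/is_cobdryE eg : cclass g' = cclass g by rewrite /cclass reprK.
transitivity (cclass (cup_cocycle f g')); apply/cclass_eqP.
- have eq y : cext (cup_cocycle f' g' - cup_cocycle f g' : cocycle _ _) y =
      tens (cext (f' - f : cocycle _ _) y) (cext g' (fun j => y (p + j)%N)).
    rewrite (tensBl (cext g' (fun j => y (p + j)%N)) (cext f' y) (cext f y)).
    by rewrite -!cext_cup.
  case: ef => [f0|[m [h [e he hf]]]].
    by apply: is_cobdry0 => y; rewrite eq f0 tens0l.
  apply: (@is_cobdryI _ _ (m + q) _ _ (cup_cochain h g')).
  + by rewrite -addSn e.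
  + by apply: cup_equivariant => //; case: (cocycleP g').
  + by move=> y; rewrite cup_leibniz cdN_cocycle raddf0 mul0rz addr0 eq hf e.
- have eq y : cext (cup_cocycle f g' - cup_cocycle f g : cocycle _ _) y =
      tens (cext f y) (cext (g' - g : cocycle _ _) (fun j => y (p + j)%N)).
    rewrite (tensBr (cext f y) (cext g' (fun j => y (p + j)%N))
      (cext g (fun j => y (p + j)%N))).
    by rewrite -!cext_cup.
  case: eg => [g0|[m [h [e he hg]]]].
    by apply: is_cobdry0 => y; rewrite eq g0 raddf0.
  have hE : equivariant (fun x => cup_cochain f h x *~ (-1) ^+ p).
    move=> k x; rewrite (cup_equivariant (proj1 (cocycleP f)) he).
    exact: (esym (raddfMz (@gact G (gtensor M N) k) _ _)).
  apply: (@is_cobdryI _ _ (p + m) _ _ _ _ hE); first by rewrite -addnS e.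
  move=> y; rewrite eq -hg.
  have -> : cdN (fun x => cup_cochain f h x *~ (-1) ^+ p) y =
      cdN (cup_cochain f h) y *~ (-1) ^+ p.
    by rewrite /cdN mulrz_suml; apply: eq_bigr => i _; rewrite mulrzAC.
  rewrite cup_leibniz cdN_cocycle tens0l add0r -mulrzA -exprD addnn -mul2n.
  by rewrite exprM sqrrN !expr1n mulr1z.
Qed.

End Cup.

Lemma one_is_cocycle (G : groupType) :
  is_cocycle ((fun=> 1) : cochain 0 (trivZ G)).
Proof.
by split=> // x; rewrite /cobdry !big_ord_recl big_ord0 expr0 addr0 mulr1z subrr.
Qed.

Definition cohom1 (G : groupType) : cohomology 0 (trivZ G) :=
  cclass (mkcocycle (@one_is_cocycle G)).

Fixpoint cup_pow (G : groupType) (M : gmodule G) (a : cohomology 1 M) (n : nat) :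
    cohomology n (tpow M n) :=
  match n with
  | 0 => cohom1 G
  | k.+1 =>
    match k return cohomology k (tpow M k) -> cohomology k.+1 (tpow M k.+1) with
    | 0 => fun _ => a
    | l.+1 => fun b => cup a b
    end (cup_pow a k)
  end.

Section Berstein.
Variable G : groupType.

(* The standard K(G, 1) has a single vertex x0, and the fibre of EG over it is G.
   The group H_1(EG, G) is generated by the edges of EG, and the isomorphism
   H_1(EG, G) -> I(G) is the connecting map to H_0(G) = Z[G], which sends the edge
   (x_0, x_1) to its boundary x_1 - x_0. *)
Lemma edge_subproof (x : 'I_2 -> G) : <<x ord_max>> - <<x ord0>> \in @augI_pred G.
Proof. by rewrite unfold_in raddfB /= !degU subrr. Qed.

Definition edge_bdry (x : 'I_2 -> G) : augI G := AugI (edge_subproof x).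

Lemma cobdry1E (M : gmodule G) (f : cochain 1 M) (x : 'I_3 -> G) :
  cobdry f x = f (fun j => x (inord j.+1)) -
    f (fun j => x (inord j.*2)) + f (fun j => x (inord j)).
Proof.
rewrite /cobdry !big_ord_recl big_ord0 addr0 addrA expr0 mulr1z expr1 mulrN1z.
rewrite expr2 mulN1r opprK mulr1z; congr (f _ - f _ + f _);
  apply/funext; case=> [[|[|//]] ji] /=; congr (x _); apply: val_inj;
  by rewrite /= inordK.
Qed.

Lemma hom_cocycle_subproof (M : gmodule G) (phi : ghom (augI G) M) :
  is_cocycle ((fun x => phi (edge_bdry x)) : cochain 1 M).
Proof.
split=> [g x|x].
  rewrite -ghom_act; congr (phi _); apply: val_inj => /=.
  by rewrite raddfB /= !ltransU.
rewrite cobdry1E -raddfB -raddfD -[RHS](raddf0 phi); congr (phi _).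
have e (a b c : {freeg G}) : (c - b) - (c - a) + (b - a) = 0.
  by rewrite addrAC addrA subrK subrr.
by apply: val_inj; exact: e.
Qed.

(* There are no nonzero relative 0-cochains on (K(G, 1), x0), and 1-cocycles vanish
   on the degenerate edges (cf. [cocycle1_deg]), so H^1(K(G, 1), x0; M) is the group
   of 1-cocycles.  This is the isomorphism Hom_(Z[G])(I(G), M) ->
   H^1(K(G, 1), x0; M), see [hom_cocycle_bij]. *)
Definition hom_cocycle (M : gmodule G) (phi : ghom (augI G) M) : cocycle 1 M :=
  mkcocycle (hom_cocycle_subproof phi).

Definition berstein_rel : cocycle 1 (augI G) := hom_cocycle (ghom_id (augI G)).

(* [cclass] plays the role of H^1(K(G, 1), x0; -) -> H^1(K(G, 1); -). *)
Definition berstein : cohomology 1 (augI G) := cclass berstein_rel.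

Definition edge (g h : G) : 'I_2 -> G := fun i => if i == ord0 then g else h.

Lemma edgeE (x : 'I_2 -> G) : x = edge (x ord0) (x ord_max).
Proof.
by apply/funext; case=> [[|[|//]] ji]; congr (x _); apply: val_inj.
Qed.

Lemma cocycle1D (M : gmodule G) (z : cocycle 1 M) a b c :
  z (edge a c) = z (edge a b) + z (edge b c).
Proof.
pose x (i : 'I_3) := nth a [:: a; b; c] i.
have := proj2 (cocycleP z) x; rewrite cobdry1E.
have e k : (k < 3)%N -> x (inord k) = nth a [:: a; b; c] k.
  by move=> k3; rewrite /x inordK.
rewrite [X in z X - _](_ : _ = edge b c); last first.
  by rewrite [LHS]edgeE; congr edge; rewrite e.
rewrite [X in _ - z X](_ : _ = edge a c); last first.
  by rewrite [LHS]edgeE; congr edge; rewrite e.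
rewrite [X in _ + z X](_ : _ = edge a b); last first.
  by rewrite [LHS]edgeE; congr edge; rewrite e.
by move/eqP; rewrite addrAC subr_eq0 addrC => /eqP.
Qed.

Lemma cocycle1_deg (M : gmodule G) (z : cocycle 1 M) a : z (edge a a) = 0.
Proof. by apply: (@addrI _ (z (edge a a))); rewrite -cocycle1D addr0. Qed.

Section HomOfCocycle.
Variables (M : gmodule G) (z : cocycle 1 M).

Definition hom_of_fun (x : augI G) : M :=
  fgext (fun g => z (edge 1%g g)) (val x).

Lemma hom_of_zmod : zmod_morphism hom_of_fun.
Proof. by move=> x y; rewrite /hom_of_fun /= raddfB. Qed.

Lemma hom_of_act g x : hom_of_fun (gact g x) = gact g (hom_of_fun x).
Proof.
pose v (y : {freeg G}) : M :=
  gact g (fgext (fun g => z (edge 1%g g)) y) + z (edge 1%g g) *~ deg y.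
have vB : zmod_morphism v.
  by move=> a b; rewrite /v degB raddfB /= raddfB /= mulrzBr opprD addrACA.
pose v' : {additive {freeg G} -> M} :=
  HB.pack v (GRing.isZmodMorphism.Build {freeg G} M v vB).
rewrite /hom_of_fun /=.
pose w := (fgext (fun h => z (edge 1%g h)) \o ltrans g)%FUN.
have -> : fgext (fun h => z (edge 1%g h)) (ltrans g (val x)) = v (val x).
  apply: (@freeg_morph_eq _ _ w v') => h.
  rewrite /= /v /w ltransU !fgextU degU mulr1z (@cocycle1D M z 1%g g (g * h)%g).
  rewrite addrC -(proj1 (cocycleP z)); congr (z _ + _); apply/funext => i.
  by rewrite /edge; case: ifP; rewrite ?mulg1.
by rewrite /v (eqP (valP x : deg _ == 0)) mulr0z addr0.
Qed.

Definition hom_of_cocycle : ghom (augI G) M := GHom hom_of_zmod hom_of_act.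

End HomOfCocycle.

Lemma hom_cocycle_bij (M : gmodule G) (z : cocycle 1 M) :
  exists phi, hom_cocycle phi = z /\ 
    forall psi, hom_cocycle psi = z -> forall x, psi x = phi x.
Proof.
have phiz : hom_cocycle (hom_of_cocycle z) = z.
  apply: val_inj; apply/funext => x /=; rewrite /hom_of_fun /= raddfB /= !fgextU.
  by rewrite (@cocycle1D M z 1%g (x ord0)) addrC addKr -edgeE.
exists (hom_of_cocycle z); split=> //  psi psiz x.
pose e : {freeg G} -> augI G := fgext (fun h => edge_bdry (edge 1%g h)).
have ve y : val (e y) = y - <<1%g>> *~ deg y.
  pose u (y : {freeg G}) : {freeg G} := y - <<1%g>> *~ deg y.
  have uB : zmod_morphism u.
    by move=> a b; rewrite /u degB mulrzBr !opprD addrACA.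
  pose u' : {additive {freeg G} -> {freeg G}} :=
    HB.pack u (GRing.isZmodMorphism.Build {freeg G} {freeg G} u uB).
  apply: (@freeg_morph_eq _ _ (val \o e)%FUN u') => h.
  by rewrite /= /u /e fgextU degU mulr1z.
have -> : x = e (val x).
  by apply: val_inj; rewrite ve (eqP (valP x : deg _ == 0)) mulr0z subr0.
apply: (@freeg_morph_eq _ _ (psi \o e)%FUN (hom_of_cocycle z \o e)%FUN) => h.
rewrite /= /e fgextU.
by have /(congr1 (fun w : cocycle 1 M => w (edge 1%g h))) := etrans psiz (esym phiz).
Qed.

End Berstein.

(* Main.v *)
Require Import Defs.
From HB Require Import structures.
From mathcomp Require Import all_boot all_order all_algebra.
From mathcomp Require Import boolp functions freeg.

(** Write I = I(pi), and I^k for its k-fold tensor power.  Up to sign, b^n is the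
    class in Ext^n(Z, I^n) of the exact sequence
      0 -> I^n -> Z[pi] (x) I^(n-1) -> ... -> Z[pi] (x) I -> Z[pi] -> Z -> 0
    spliced from the sequences 0 -> I^(k+1) -> Z[pi] (x) I^k -> I^k -> 0
    ([short_exact_bres]), all of whose middle terms are projective because I^k is
    Z-projective ([projective_bres]).  If b^n vanishes, then the identity of I^n
    extends over Z[pi] (x) I^(n-1) ([extension_of_cobdry]); so the last inclusion
    splits, I^(n-1) is projective ([projective_quotient]), and the sequence
    truncated at I^(n-1) is a projective resolution of Z of length n-1
    ([resolution_splice]).  This contradicts the minimality of n = cd pi.

    The heart is [extension_of_cobdry]: a map phi : I^(k+1) -> N such that
    phi_* b^(k+1) = delta h extends over Z[pi] (x) I^k.  It is proved on cochains
    by induction on k, for all N at once, by shifting the dimension in the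
    coefficients.  Currying turns phi : I (x) I^k -> N into a map
    Phi : I^k -> Hom(I, N), and Phi_* b^k is the coboundary of the cochain that
    sends y to the restriction to I of the additive extension of x |-> h(x, y)
    ([cdN_partial]).  So Phi extends over the projective term below, lifts there
    along the surjection Hom(Z[pi], N) -> Hom(I, N), and uncurrying the lift yields
    the extension of phi. *)

Set Implicit Arguments.
Unset Strict Implicit.
Unset Printing Implicit Defensive.

Import GRing.Theory.
Local Open Scope ring_scope.

(** * Additive maps and internal Hom modules *)

Lemma freeg_ext (K : choiceType) (A : zmodType) (u v : {freeg K} -> A) :
  zmod_morphism u -> zmod_morphism v ->
  (forall k, u <<k>> = v <<k>>) -> u =1 v.
Proof.
move=> uB vB e.
pose u' : {additive {freeg K} -> A} :=
  HB.pack u (GRing.isZmodMorphism.Build {freeg K} A u uB).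
pose v' : {additive {freeg K} -> A} :=
  HB.pack v (GRing.isZmodMorphism.Build {freeg K} A v vB).
exact: (@freeg_morph_eq _ _ u' v').
Qed.

Lemma zmod_comp (A B C : zmodType) (u : B -> C) (v : A -> B) :
  zmod_morphism u -> zmod_morphism v -> zmod_morphism (u \o v).
Proof. by move=> uB vB x y; rewrite /= vB uB. Qed.

Section AddHom.
Variables A B : zmodType.

Definition addhom_pred : {pred A -> B} := fun f => `[< zmod_morphism f >].

Lemma addhom_pred_closed : zmod_closed addhom_pred.
Proof.
split=> [|f g /asboolP fB /asboolP gB]; apply/asboolP => x y.
  by rewrite [RHS]subr0.
change (f (x - y) - g (x - y) = (f x - g x) - (f y - g y)).
by rewrite fB gB !opprD addrACA.
Qed.

HB.instance Definition _ :=
  GRing.isZmodClosed.Build (A -> B) addhom_pred addhom_pred_closed.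

Record addhom := AddHom {
  addhom_val :> A -> B;
  addhom_valP : addhom_val \in addhom_pred }.

HB.instance Definition _ := [isSub for addhom_val].
HB.instance Definition _ := [Choice of addhom by <:].
HB.instance Definition _ := [SubChoice_isSubZmodule of addhom by <:].

Lemma addhom_zmod (f : addhom) : zmod_morphism f.
Proof. by have /asboolP := addhom_valP f. Qed.

HB.instance Definition _ (f : addhom) :=
  GRing.isZmodMorphism.Build A B f (addhom_zmod f).

Definition mkaddhom (f : A -> B) (fB : zmod_morphism f) : addhom :=
  AddHom (asboolT fB).

Lemma addhom_ext (f g : addhom) : f =1 g -> f = g.
Proof. by move=> e; apply: val_inj; apply/funext. Qed.

Lemma addhomB (f g : addhom) x : (f - g) x = f x - g x.
Proof. by []. Qed.

End AddHom.

Section GHomModule.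
Variables (G : groupType) (M N : gmodule G).

Lemma conj_zmod g (f : addhom M N) :
  zmod_morphism (fun m => gact g (f (gact g^-1%g m))).
Proof. by move=> x y; rewrite !raddfB. Qed.

(** The action is by conjugation, which makes the tensor-Hom adjunction below
    equivariant for the diagonal action on tensor products. *)
Definition conj_act g (f : addhom M N) : addhom M N := mkaddhom (conj_zmod g f).

Lemma conj_act_zmod g : zmod_morphism (conj_act g).
Proof. by move=> x y; apply: addhom_ext => m; rewrite addhomB /= -raddfB. Qed.

Lemma conj_act1 f : conj_act 1%g f = f.
Proof. by apply: addhom_ext => m; rewrite /= invg1 !gact1. Qed.

Lemma conj_actM g h f : conj_act (g * h)%g f = conj_act g (conj_act h f).
Proof. by apply: addhom_ext => m; rewrite /= invgM !gactM. Qed.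

Definition ghomZ : gmodule G := GModule conj_act_zmod conj_act1 conj_actM.

End GHomModule.

Section Currying.
Variables (G : groupType) (A B N : gmodule G).

Section Curry.
Variable phi : ghom (gtensor A B) N.

Lemma curry_zmod1 b : zmod_morphism (fun a => phi (tens a b)).
Proof. by move=> x y; rewrite tensBl raddfB. Qed.

Definition curry_fun b : ghomZ A N := mkaddhom (curry_zmod1 b).

Lemma curry_zmod : zmod_morphism curry_fun.
Proof. by move=> x y; apply: addhom_ext => a; rewrite addhomB /= !raddfB. Qed.

Lemma curry_act g b : curry_fun (gact g b) = gact g (curry_fun b).
Proof.
apply: addhom_ext => a; rewrite /= -ghom_act /= tens_actE.
by rewrite -gactM mulgV gact1.
Qed.

Definition gcurry : ghom B (ghomZ A N) := GHom curry_zmod curry_act.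

End Curry.

Section Uncurry.
Variable psi : ghom B (ghomZ A N).

Lemma uncurry_l b : zmod_morphism (fun a => (psi b : addhom A N) a).
Proof. exact: addhom_zmod. Qed.

Lemma uncurry_r a : zmod_morphism (fun b => (psi b : addhom A N) a).
Proof. by move=> x y; rewrite raddfB. Qed.

Definition uncurry_fun : gtensor A B -> N :=
  tens_lift (fun a b => (psi b : addhom A N) a).

Lemma uncurryE a b : uncurry_fun (tens a b) = (psi b : addhom A N) a.
Proof. by rewrite /uncurry_fun tens_liftE //; [exact: uncurry_l|exact: uncurry_r]. Qed.

Lemma uncurry_zmod : zmod_morphism uncurry_fun.
Proof. by apply: tens_lift_zmod; [exact: uncurry_l|exact: uncurry_r]. Qed.

Lemma uncurry_act g t : uncurry_fun (gact g t) = gact g (uncurry_fun t).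
Proof.
apply: (tens_morph_eq (zmod_comp uncurry_zmod (@gact_zmod _ (gtensor A B) g))
  (zmod_comp (@gact_zmod _ N g) uncurry_zmod)) => a b /=.
by rewrite tens_actE !uncurryE ghom_act /= -gactM mulVg gact1.
Qed.

Definition guncurry : ghom (gtensor A B) N := GHom uncurry_zmod uncurry_act.

End Uncurry.
End Currying.

Section Restriction.
Variables (G : groupType) (A B N : gmodule G) (i : ghom A B).

Lemma restr_zmod1 (f : ghomZ B N) : zmod_morphism (fun a => (f : addhom B N) (i a)).
Proof. by move=> x y; rewrite !raddfB. Qed.

Definition restr_fun (f : ghomZ B N) : ghomZ A N := mkaddhom (restr_zmod1 f).

Lemma restr_zmod : zmod_morphism restr_fun.
Proof. by move=> f g; apply: addhom_ext. Qed.

Lemma restr_act g f : restr_fun (gact g f) = gact g (restr_fun f).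
Proof. by apply: addhom_ext => a; rewrite /= ghom_act. Qed.

Definition grestr : ghom (ghomZ B N) (ghomZ A N) := GHom restr_zmod restr_act.

End Restriction.

Section Compose.
Variables (G : groupType) (A B C : gmodule G) (v : ghom B C) (u : ghom A B).

Lemma gcomp_act g a : v (u (gact g a)) = gact g (v (u a)).
Proof. by rewrite !ghom_act. Qed.

Definition gcomp : ghom A C :=
  GHom (zmod_comp (@ghom_zmod _ _ _ v) (@ghom_zmod _ _ _ u)) gcomp_act.

End Compose.

(** * Projectivity over Z *)

Definition zprojective (A : zmodType) : Prop :=
  forall (M N : zmodType) (p : {additive M -> N}) (f : {additive A -> N}),
    (forall y, exists x, p x = y) ->
    exists2 l : A -> M, zmod_morphism l & forall a, p (l a) = f a.

(** Since Hom(A (x) B, -) = Hom(A, Hom(B, -)), surjections can be lifted through one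
    factor at a time; this avoids any basis of the tensor product. *)
Lemma zprojective_tensor (A B : zmodType) :
  zprojective A -> zprojective B -> zprojective (tensor A B).
Proof.
move=> hA hB M N p f ps.
have postB (l : addhom B M) : zmod_morphism (fun b => p (l b)).
  by move=> x y; rewrite !raddfB.
pose post (l : addhom B M) : addhom B N := mkaddhom (postB l).
have post_zmod : zmod_morphism post.
  by move=> x y; apply: addhom_ext => b; rewrite addhomB /= -raddfB.
have curB a : zmod_morphism (fun b => f (tens a b)).
  by move=> x y; rewrite !raddfB.
pose cur a : addhom B N := mkaddhom (curB a).
have cur_zmod : zmod_morphism cur.
  by move=> x y; apply: addhom_ext => b; rewrite addhomB /= tensBl raddfB.
pose post' : {additive addhom B M -> addhom B N} :=
  HB.pack post (GRing.isZmodMorphism.Build _ _ post post_zmod).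
pose cur' : {additive A -> addhom B N} :=
  HB.pack cur (GRing.isZmodMorphism.Build _ _ cur cur_zmod).
have [|l lB hl] := hA _ _ post' cur'.
  move=> y; have [l lB hl] := hB _ _ p y ps.
  by exists (mkaddhom lB); apply: addhom_ext.
have blB b : zmod_morphism (fun a => l a b) by move=> x y; rewrite lB.
have brB a : zmod_morphism (fun b => l a b) by exact: addhom_zmod.
have LB := tens_lift_zmod blB brB.
exists (tens_lift (fun a b => l a b)) => // t.
apply: (tens_morph_eq (zmod_comp (@raddfB _ _ p) LB) (@raddfB _ _ f)) => a b /=.
rewrite tens_liftE //.
by have /(congr1 (fun w : addhom B N => w b)) := hl a.
Qed.

(** * The augmentation ideal and induced modules *)

Section AugmentationIdeal.
Variable G : groupType.

(** The Z-linear retraction x |-> x - deg(x) g of Z[G] onto I(G), cf.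
    [val_augI_proj].  It is not equivariant; the base point g is a
    parameter because [cdN_partial] needs it to be the first vertex of a simplex. *)
Definition augI_proj (g : G) (x : {freeg G}) : augI G :=
  fgext (fun h => edge_bdry (edge g h)) x.

Lemma augI_proj_zmod g : zmod_morphism (augI_proj g).
Proof. exact: fgext_zmod. Qed.

Lemma augI_projU g h : augI_proj g <<h>> = edge_bdry (edge g h).
Proof. exact: fgextU. Qed.

Lemma val_augI_proj g x : val (augI_proj g x) = x - <<g>> *~ deg x.
Proof.
apply: (@freeg_ext _ _ (val \o augI_proj g) (fun x => x - <<g>> *~ deg x)).
- exact: zmod_comp (fun _ _ => erefl) (augI_proj_zmod g).
- by move=> y z; rewrite degB mulrzBr !opprD addrACA.
- by move=> h; rewrite /= augI_projU degU mulr1z.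
Qed.

Lemma deg_augI (a : augI G) : deg (val a) = 0.
Proof. exact: (eqP (valP a : deg _ == 0)). Qed.

Lemma augI_projK g (a : augI G) : augI_proj g (val a) = a.
Proof. by apply: val_inj; rewrite val_augI_proj deg_augI mulr0z subr0. Qed.

(** A Z-linear summand of the free group Z[G] is Z-projective. *)
Lemma zprojective_augI : zprojective (augI G).
Proof.
move=> M N p f ps.
have [s hs] := choice (fun g : G => ps (f (augI_proj 1%g <<g>>))).
exists (fgext s \o val); first exact: zmod_comp (@fgext_zmod _ _ s) (fun _ _ => erefl).
move=> a; rewrite -{2}(augI_projK 1%g a) /=; move: (val a).
apply: freeg_ext => [||g]; last by rewrite fgextU hs.
- exact: zmod_comp (@raddfB _ _ p) (@fgext_zmod _ _ s).
- exact: zmod_comp (@raddfB _ _ f) (augI_proj_zmod 1%g).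
Qed.

Lemma augI_incl_zmod : zmod_morphism (fun a : augI G => val a : zgroup_ring G).
Proof. by []. Qed.

Definition augI_incl : ghom (augI G) (zgroup_ring G) :=
  GHom augI_incl_zmod (fun _ _ => erefl).

Lemma deg_act (g : G) x : deg (gact g (x : zgroup_ring G)) = gact g (deg x : trivZ G).
Proof. exact: deg_ltrans. Qed.

Definition gdeg : ghom (zgroup_ring G) (trivZ G) :=
  @GHom G (zgroup_ring G) (trivZ G) (@deg G) (@degB G) deg_act.

Section Orbit.
Variables (M : gmodule G) (m : M).

Lemma orbit_act g x : fgext (fun h => gact h m) (ltrans g x) =
  gact g (fgext (fun h => gact h m) x).
Proof.
apply: (@freeg_ext _ _ (fgext _ \o ltrans g) (gact g \o fgext _)) => [||h].
- exact: zmod_comp (@fgext_zmod _ _ _) (@ltrans_zmod _ g).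
- exact: zmod_comp (@gact_zmod _ M g) (@fgext_zmod _ _ _).
- by rewrite /= ltransU !fgextU gactM.
Qed.

(** The map classified by m, as Z[G] is free on one generator. *)
Definition gorbit : ghom (zgroup_ring G) M :=
  @GHom G (zgroup_ring G) M _ (@fgext_zmod _ _ (fun h => gact h m)) orbit_act.

Lemma gorbitU g : gorbit <<g>> = gact g m.
Proof. exact: fgextU. Qed.

End Orbit.

Lemma projective_zgroup_ring : projective (zgroup_ring G).
Proof.
move=> M N p f ps; have [m hm] := ps (f <<1%g>>).
exists (gorbit m); apply: freeg_ext => [||g].
- exact: zmod_comp (@ghom_zmod _ _ _ p) (@ghom_zmod _ _ _ (gorbit m)).
- exact: (@ghom_zmod _ _ _ f).
- by rewrite gorbitU ghom_act hm -ghom_act /= ltransU mulg1.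
Qed.

Section Induced.
Variable A : gmodule G.
Let Ind := gtensor (zgroup_ring G) A.

Lemma ind_ext (N : gmodule G) (u v : Ind -> N) :
  zmod_morphism u -> zmod_morphism v ->
  (forall g a, u (tens <<g>> a) = v (tens <<g>> a)) -> u =1 v.
Proof.
move=> uB vB e; apply: tens_morph_eq => // x a; move: x.
apply: freeg_ext => // [x y|x y]; by rewrite tensBl ?uB ?vB.
Qed.

(** With the diagonal action too, Z[G] (x) A is induced from the trivial subgroup:
    an equivariant map out of it is determined by its restriction to 1 (x) A, an
    arbitrary additive map, through g (x) a |-> g l(g^-1 a).  So a lift over Z of this
    restriction is enough. *)
Lemma projective_induced : zprojective A -> projective Ind.
Proof.
move=> hA M N p f ps.
have f1B : zmod_morphism (fun a => f (tens <<1%g>> a)).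
  by move=> x y; rewrite !raddfB.
have [l lB hl] := hA _ _ p (mkaddhom f1B) ps.
pose c a g := gact g (l (gact g^-1%g a)).
have clB a : zmod_morphism (fun x => fgext (c a) x) by exact: fgext_zmod.
have crB x : zmod_morphism (fun a => fgext (c a) x).
  move=> a b; move: x; apply: freeg_ext => [||g]; first exact: fgext_zmod.
    by move=> x y; rewrite !raddfB addrACA.
  by rewrite !fgextU /c raddfB lB raddfB.
have hadd := tens_lift_zmod clB crB.
set h := tens_lift _ in hadd.
have hE g a : h (tens <<g>> a) = c a g by rewrite /h tens_liftE // fgextU.
have hact g (t : Ind) : h (gact g t) = gact g (h t).
  move: t; apply: ind_ext => [||k a].
  - exact: zmod_comp hadd (@gact_zmod _ Ind g).
  - exact: zmod_comp (@gact_zmod _ M g) hadd.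
  - by rewrite /= tens_actE /= ltransU !hE /c -!gactM invgM -mulgA mulVg mulg1.
exists (@GHom G Ind M h hadd hact); apply: ind_ext => [||g a].
- exact: zmod_comp (@ghom_zmod _ _ _ p) hadd.
- exact: (@ghom_zmod _ _ _ f).
- rewrite /= hE /c ghom_act hl -ghom_act /= tens_actE /= ltransU mulg1.
  by rewrite -gactM mulgV gact1.
Qed.

Lemma tens_incl_l (a : A) : zmod_morphism (fun x : augI G => tens (val x) a).
Proof. by move=> x y; rewrite raddfB tensBl. Qed.

Lemma tens_incl_r (x : augI G) : zmod_morphism (fun a : A => tens (val x) a).
Proof. by move=> a b; rewrite raddfB. Qed.

Definition ind_incl_fun : gtensor (augI G) A -> Ind :=
  tens_lift (fun (x : augI G) (a : A) => tens (val x) a).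

Lemma ind_inclE x a : ind_incl_fun (tens x a) = tens (val x) a.
Proof. by rewrite /ind_incl_fun tens_liftE //; [exact: tens_incl_l|exact: tens_incl_r]. Qed.

Lemma ind_incl_zmod : zmod_morphism ind_incl_fun.
Proof. by apply: tens_lift_zmod; [exact: tens_incl_l|exact: tens_incl_r]. Qed.

Lemma ind_incl_act g t : ind_incl_fun (gact g t) = gact g (ind_incl_fun t).
Proof.
apply: (tens_morph_eq (zmod_comp ind_incl_zmod (@gact_zmod _ (gtensor (augI G) A) g))
  (zmod_comp (@gact_zmod _ Ind g) ind_incl_zmod)) => x a.
by rewrite /= tens_actE !ind_inclE tens_actE.
Qed.

Definition ind_incl : ghom (gtensor (augI G) A) Ind := GHom ind_incl_zmod ind_incl_act.

Lemma ind_aug_l (a : A) : zmod_morphism (fun x : {freeg G} => a *~ deg x).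
Proof. by move=> x y; rewrite raddfB mulrzBr. Qed.

Lemma ind_aug_r (x : {freeg G}) : zmod_morphism (fun a : A => a *~ deg x).
Proof. by move=> a b; rewrite mulrzBl. Qed.

Definition ind_aug_fun : Ind -> A := tens_lift (fun x (a : A) => a *~ deg x).

Lemma ind_augE x a : ind_aug_fun (tens x a) = a *~ deg x.
Proof. by rewrite /ind_aug_fun tens_liftE //; [exact: ind_aug_l|exact: ind_aug_r]. Qed.

Lemma ind_aug_zmod : zmod_morphism ind_aug_fun.
Proof. by apply: tens_lift_zmod; [exact: ind_aug_l|exact: ind_aug_r]. Qed.

Lemma ind_aug_act g t : ind_aug_fun (gact g t) = gact g (ind_aug_fun t).
Proof.
apply: (tens_morph_eq (zmod_comp ind_aug_zmod (@gact_zmod _ Ind g))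
  (zmod_comp (@gact_zmod _ A g) ind_aug_zmod)) => x a.
by rewrite /= tens_actE !ind_augE /= deg_ltrans raddfMz.
Qed.

Definition ind_aug : ghom Ind A := GHom ind_aug_zmod ind_aug_act.

End Induced.
End AugmentationIdeal.

(** * The sequences that represent the powers of the Berstein class *)

Definition short_exact (G : groupType) (K P M : gmodule G)
    (i : ghom K P) (q : ghom P M) : Prop :=
  [/\ forall x, i x = 0 -> x = 0,
      forall y, q y = 0 <-> exists x, i x = y &
      forall z, exists y, q y = z].

Section BersteinSequences.
Variable G : groupType.

Lemma short_exact_augI : short_exact (augI_incl G) (gdeg G).
Proof.
split=> [x x0|y|k]; first exact: val_inj.
  split=> [y0|[x <-]]; last exact: deg_augI.
  exists (augI_proj 1%g y); rewrite /= val_augI_proj.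
  by rewrite (y0 : deg y = 0) mulr0z subr0.
by exists (<<1%g>> *~ k); rewrite /= raddfMz /= degU intz.
Qed.

(** Tensoring with A preserves exactness because the sequence of Z[G] splits over Z:
    r = (x |-> x - deg x) (x) A is an additive retraction of the inclusion, and
    t - i (r t) = 1 (x) aug t. *)
Lemma short_exact_induced (A : gmodule G) : short_exact (ind_incl A) (ind_aug A).
Proof.
pose Ind := gtensor (zgroup_ring G) A; pose K := gtensor (augI G) A.
pose b (x : zgroup_ring G) (a : A) := tens (augI_proj 1%g x) a : K.
have bl a : zmod_morphism (b^~ a) by move=> x y; rewrite /b augI_proj_zmod tensBl.
have br x : zmod_morphism (b x) by move=> a c; rewrite /b raddfB.
pose r : Ind -> K := tens_lift b.
have rB : zmod_morphism r := tens_lift_zmod bl br.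
have rE x a : r (tens x a) = b x a by rewrite /r tens_liftE.
have rK : cancel (ind_incl A) r.
  apply: (@tens_morph_eq _ _ _ (r \o ind_incl A) id) => // [|x a].
    exact: (zmod_comp rB (@ghom_zmod _ _ _ (ind_incl A))).
  by rewrite /= ind_inclE rE /b augI_projK.
have split_t (t : Ind) : t = ind_incl A (r t) + tens <<1%g>> (ind_aug A t).
  move: t; apply: tens_morph_eq => // [s t|x a].
    by rewrite rB !raddfB /= addrACA -opprD.
  rewrite rE /b /= ind_inclE ind_augE raddfMz /= -tensMzl -tensDl.
  by rewrite val_augI_proj subrK.
split=> [x x0|y|a]; first by rewrite -[x]rK x0; have := rB 0 0; rewrite !subrr.
  split=> [y0|[x <-]]; first by exists (r y); rewrite {2}[y]split_t y0 raddf0 addr0.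
  move: x; apply: (@tens_morph_eq _ _ _ (ind_aug A \o ind_incl A) (fun=> 0)).
  - exact: (@ghom_zmod _ _ _ (gcomp (ind_aug A) (ind_incl A))).
  - by move=> *; rewrite subrr.
  - by move=> x a; rewrite /= ind_inclE ind_augE deg_augI mulr0z.
by exists (tens <<1%g>> a); rewrite /= ind_augE degU.
Qed.

(** I^0 is Z, but the term over it is Z[G] itself rather than Z[G] (x) Z, so that the
    kernel is literally the first tensor power I(G). *)
Definition bres (k : nat) : gmodule G :=
  if k is _.+1 then gtensor (zgroup_ring G) (tpow (augI G) k) else zgroup_ring G.

Definition bres_incl (k : nat) : ghom (tpow (augI G) k.+1) (bres k) :=
  match k with 0 => augI_incl G | k'.+1 => ind_incl (tpow (augI G) k'.+1) end.

Definition bres_aug (k : nat) : ghom (bres k) (tpow (augI G) k) :=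
  match k with 0 => gdeg G | k'.+1 => ind_aug (tpow (augI G) k'.+1) end.

Lemma short_exact_bres k : short_exact (bres_incl k) (bres_aug k).
Proof. by case: k => [|k]; [exact: short_exact_augI|exact: short_exact_induced]. Qed.

Lemma zprojective_tpow k : zprojective (tpow (augI G) k.+1).
Proof.
elim: k => [|k IH]; first exact: zprojective_augI.
exact: zprojective_tensor (@zprojective_augI G) IH.
Qed.

Lemma projective_bres k : projective (bres k).
Proof.
case: k => [|k]; first exact: projective_zgroup_ring.
exact: (@projective_induced G (tpow (augI G) k.+1) (@zprojective_tpow k)).
Qed.

(** Its value at (y_0, .., y_k) is (y_1 - y_0) (x) .. (x) (y_k - y_(k-1)). *)
Fixpoint berstein_cocycle (k : nat) : cocycle k (tpow (augI G) k) :=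
  match k with
  | 0 => mkcocycle (@one_is_cocycle G)
  | k'.+1 =>
    match k' return cocycle k' (tpow (augI G) k') ->
                    cocycle k'.+1 (tpow (augI G) k'.+1) with
    | 0 => fun _ => berstein_rel G
    | l.+1 => fun z => cup_cocycle (berstein_rel G) z
    end (berstein_cocycle k')
  end.

Lemma cup_pow_berstein k : cup_pow (berstein G) k = cclass (berstein_cocycle k).
Proof.
elim: k => [//|[//|k] IH].
rewrite [LHS]/(cup (berstein G) (cup_pow (berstein G) k.+1)) IH.
exact: (cup_cclass (berstein_rel G) (berstein_cocycle k.+1)).
Qed.

Lemma cext_berstein_cocycleSS k (y : nat -> G) :
  cext (berstein_cocycle k.+2) y =
  tens (edge_bdry (edge (y 0) (y 1))) (cext (berstein_cocycle k.+1) (fun j => y j.+1)).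
Proof.
rewrite [LHS](@cext_cup G 1 k.+1); congr tens.
by congr edge_bdry; rewrite [LHS]edgeE.
Qed.

(** * Extension of homomorphisms that kill a power of the Berstein class *)

Definition vcons (x : G) (y : nat -> G) (j : nat) : G :=
  if j is j'.+1 then y j' else x.

Lemma cdN_vcons (M : gmodule G) k (h : cochain k.+1 M) x (y : nat -> G) :
  cdN h (vcons x y) = cext h y -
    \sum_(0 <= i < k.+2) cext h (vcons x (fun j => y (bump i j))) *~ (-1) ^+ i.
Proof.
rewrite /cdN big_nat_recl //= expr0 mulr1z; congr (_ + _).
rewrite -sumrN; apply: eq_big_nat => i _.
rewrite exprS mulN1r mulrNz; congr (- (_ *~ _)).
by apply: cext_eq => [[|j]] _ //=; rewrite bumpS.
Qed.

Section PartialCochain.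
Variables (M : gmodule G) (k : nat) (h : cochain k.+1 M).

Lemma partial_zmod (y : nat -> G) :
  zmod_morphism (fun a : augI G => fgext (fun x => cext h (vcons x y)) (val a)).
Proof. exact: zmod_comp (@fgext_zmod _ _ _) (fun _ _ => erefl). Qed.

(** It lowers the degree by one at the price of coefficients in Hom(I, M): h is extended
    additively in its first vertex and restricted to I. *)
Definition partial_cochain : cochain k (ghomZ (augI G) M) :=
  fun y => mkaddhom (partial_zmod (fun j => y (inord j))).

Lemma cext_partial y (a : augI G) :
  (cext partial_cochain y : addhom (augI G) M) a =
  fgext (fun x => cext h (vcons x y)) (val a).
Proof.
rewrite /cext /partial_cochain /=; congr fgext; apply/funext => x.
by apply: cext_eq => [[|j]] //= jk; rewrite inordK.
Qed.

Lemma partial_equivariant : equivariant h -> equivariant partial_cochain.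
Proof.
move=> hE g y; apply: addhom_ext => a; rewrite /=; move: (val a) => x.
have -> : gact g (fgext (fun x => cext h (vcons x (fun j => y (inord j))))
    (ltrans g^-1%g x)) =
  (gact g \o (fgext (fun x => cext h (vcons x (fun j => y (inord j))))
    \o ltrans g^-1%g)) x by [].
move: x; apply: freeg_ext => [||x].
- exact: fgext_zmod.
- apply: zmod_comp (@gact_zmod _ M g) _.
  exact: zmod_comp (@fgext_zmod _ _ _) (@ltrans_zmod _ _).
- rewrite /= ltransU !fgextU /cext -hE; congr h; apply/funext => [[[|j] jk]] //=.
  by rewrite mulgA mulgV mul1g.
Qed.

End PartialCochain.

(** Deleting the vertices of y in h(x, y) yields a sum S x, and the coboundary
    formula reads S x = h(y) - phi((y_0 - x) (x) b^(k+1)(y)).  Extended additively to I the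
    term h(y), constant in x, is multiplied by the degree 0, which leaves
    a |-> phi(a (x) b^(k+1)(y)). *)
Lemma cdN_partial k (N : gmodule G) (phi : ghom (tpow (augI G) k.+2) N)
    (h : cochain k.+1 N) :
  (forall y, cdN h y = phi (cext (berstein_cocycle k.+2) y)) ->
  forall y, cdN (partial_cochain h) y = gcurry phi (cext (berstein_cocycle k.+1) y).
Proof.
move=> hb y; apply: addhom_ext => a.
pose S x := \sum_(0 <= i < k.+2)
  cext h (vcons x (fun j => y (bump i j))) *~ (-1) ^+ i.
have SE x : S x = cext h y -
    phi (tens (edge_bdry (edge x (y 0))) (cext (berstein_cocycle k.+1) y)).
  rewrite -[tens _ _](cext_berstein_cocycleSS k (vcons x y)) -hb cdN_vcons.
  by rewrite opprB addrC subrK.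
transitivity (fgext S (val a)).
  pose ev (f : ghomZ (augI G) N) : N := (f : addhom (augI G) N) a.
  have evB : zmod_morphism ev by [].
  pose ev' : {additive ghomZ (augI G) N -> N} :=
    HB.pack ev (GRing.isZmodMorphism.Build _ _ ev evB).
  rewrite -[LHS]/(ev' _) /cdN raddf_sum.
  transitivity (\sum_(0 <= i < k.+2)
      fgext (fun x => cext h (vcons x (fun j => y (bump i j)))) (val a) *~ (-1) ^+ i).
    by apply: eq_bigr => i _; rewrite raddfMz; congr (_ *~ _); exact: cext_partial.
  move: (val a); apply: freeg_ext => [x z||g].
  - by rewrite -sumrB; apply: eq_bigr => i _; rewrite raddfB mulrzBl.
  - exact: fgext_zmod.
  - by rewrite fgextU; apply: eq_bigr => i _; rewrite fgextU.
pose c := cext (berstein_cocycle k.+1) y.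
have -> : fgext S (val a) = cext h y *~ deg (val a) +
    phi (tens (augI_proj (y 0) (val a)) c).
  move: (val a); apply: freeg_ext => [||x].
  - exact: fgext_zmod.
  - move=> u v; rewrite degB mulrzBr augI_proj_zmod tensBl raddfB.
    by rewrite opprD addrACA.
  - rewrite fgextU SE degU mulr1z augI_projU; congr (_ + _).
    rewrite -raddfN; congr (phi _).
    have -> : edge_bdry (edge x (y 0)) = - edge_bdry (edge (y 0) x).
      by apply: val_inj; rewrite /= opprB.
    have := tensBl c 0 (edge_bdry (edge (y 0) x)).
    by rewrite !sub0r tens0l sub0r => ->; rewrite opprK.
by rewrite deg_augI mulr0z add0r augI_projK.
Qed.

(** The induction shifts the dimension, trading N for Hom(I, N).  It starts in degree 1,
    where phi(x_1 - x_0) = h(x_1) - h(x_0) for an equivariant h : G -> N, so that the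
    Z[G]-linear extension of h extends phi. *)
Lemma extension_of_cobdry k (N : gmodule G) (phi : ghom (tpow (augI G) k.+1) N)
    (h : cochain k N) :
  equivariant h -> (forall y, cdN h y = phi (cext (berstein_cocycle k.+1) y)) ->
  exists psi : ghom (bres k) N, forall x, psi (bres_incl k x) = phi x.
Proof.
elim: k N phi h => [|k IH] N phi h hE hb.
  pose m := h (fun=> 1%g); exists (gorbit m) => a.
  have hg (g : G) : h (fun=> g) = gact g m.
    by rewrite -hE; congr h; apply/funext => i; rewrite mulg1.
  have -> : gorbit m (bres_incl 0 a) =
      phi (augI_proj 1%g (val a)) + m *~ deg (val a).
    rewrite /=; move: (val a); apply: freeg_ext => [||g].
    - exact: fgext_zmod.
    - move=> x y; rewrite degB mulrzBr augI_proj_zmod raddfB.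
      by rewrite opprD addrACA.
    - rewrite fgextU degU mulr1z augI_projU.
      have := hb (vcons 1%g (fun=> g)).
      rewrite /cdN !big_nat_recl // big_geq // addr0 expr0 expr1 mulr1z mulrN1z.
      rewrite /cext /= [X in phi (edge_bdry X)]edgeE /= => <-.
      rewrite (_ : h _ = gact g m); last by rewrite -hg; congr h.
      rewrite (_ : h _ = m) ?subrK // /m; congr h; apply/funext => i.
      by rewrite (ord1 i).
  by rewrite deg_augI mulr0z addr0 augI_projK.
(* R extends the curried map; it remains to extend its values from I to Z[G]. *)
have [R hR] := IH _ (gcurry phi) _ (partial_equivariant hE) (cdN_partial hb).
(* Surjective since I is a Z-linear summand of Z[G]. *)
have restr_surj (f : ghomZ (augI G) N) : exists F, grestr N (augI_incl G) F = f.
  have FB : zmod_morphism (fun x : zgroup_ring G => (f : addhom _ _) (augI_proj 1%g x)).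
    by move=> x y; rewrite augI_proj_zmod raddfB.
  by exists (mkaddhom FB); apply: addhom_ext => a; rewrite /= augI_projK.
have [R' hR'] := projective_bres R restr_surj.
pose psi := guncurry (gcomp R' (bres_incl k)).
exists psi => t; move: t; apply: tens_morph_eq => [||a b].
- exact: (@ghom_zmod _ _ _ (gcomp psi (bres_incl k.+1))).
- exact: (@ghom_zmod _ _ _ phi).
- rewrite /= ind_inclE uncurryE /=.
  have /(congr1 (fun w : addhom (augI G) N => w a)) := hR' (bres_incl k b).
  by rewrite hR.
Qed.

End BersteinSequences.

(** * From a retraction to a short resolution *)

(** A retraction of the kernel makes M a direct summand of P.  Concretely, a lift u of
    f \o q is corrected to v = u \o (1 - i r), which kills the kernel and so descends
    along q. *)
Lemma projective_quotient (G : groupType) (K P M : gmodule G)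
    (i : ghom K P) (q : ghom P M) (r : ghom P K) :
  short_exact i q -> cancel i r -> projective P -> projective M.
Proof.
move=> [_ ex qs] rK hP A B p f ps.
have [u hu] := hP _ _ p (gcomp f q) ps.
have [s hs] := choice qs.
pose v y := u (y - i (r y)).
have vB : zmod_morphism v by move=> x y; rewrite /v !raddfB addrACA.
have vact g y : v (gact g y) = gact g (v y).
  by rewrite /v !ghom_act -raddfB !ghom_act.
have vq x y : q x = q y -> v x = v y.
  move=> e; apply/eqP; rewrite -subr_eq0 -vB; apply/eqP.
  have /ex[z <-] : q (x - y) = 0 by rewrite raddfB /= e subrr.
  by rewrite /v rK subrr raddf0.
have wB : zmod_morphism (v \o s).
  by move=> x y; rewrite /= -vB; apply: vq; rewrite raddfB /= !hs.
have wact g x : (v \o s) (gact g x) = gact g ((v \o s) x).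
  by rewrite /= -vact; apply: vq; rewrite ghom_act !hs.
exists (GHom wB wact) => x; rewrite /= /v hu /= !raddfB /= hs.
have -> : q (i (r (s x))) = 0 by apply/ex; eexists.
by rewrite raddf0 subr0.
Qed.

Section Splicing.
Variable G : groupType.

Lemma gzero_zmod : zmod_morphism (@id 'M[int]_(0, 0)).
Proof. by []. Qed.

Definition gzero : gmodule G :=
  @GModule G 'M[int]_(0, 0) (fun=> id) (fun=> gzero_zmod) (fun=> erefl)
    (fun _ _ _ => erefl).

Lemma gzero0 (x : gzero) : x = 0. Proof. exact: thinmx0. Qed.

Lemma gnull_zmod (M N : gmodule G) : zmod_morphism (fun _ : M => 0 : N).
Proof. by move=> x y; rewrite subrr. Qed.

Lemma gnull_act (M N : gmodule G) g (x : M) : (0 : N) = gact g 0.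
Proof. by rewrite raddf0. Qed.

Definition gnull (M N : gmodule G) : ghom M N := GHom (@gnull_zmod M N) (@gnull_act M N).

Lemma resolution_projective (M : gmodule G) :
  projective M -> inhabited (proj_resolution M 0).
Proof.
move=> hM; pose obj i := if i is _.+1 then gzero else M.
pose d i : ghom (obj i.+1) (obj i) := gnull _ _.
constructor; apply: (@ProjRes G M 0 obj d (ghom_id M)).
- case=> [//|i] A B p f ps; exists (gnull _ _) => x.
  by rewrite [x]gzero0 raddf0 raddf0.
- by move=> y; exists y.
- by move=> x; split=> [x0|[y <-]] //; exists 0; rewrite [RHS]x0.
- by move=> i x; split=> // _; exists 0; rewrite [x]gzero0.
- by case=> // i _ x; exact: gzero0.
Qed.

Lemma resolution_splice (K P M : gmodule G) (i : ghom K P) (q : ghom P M) n :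
  short_exact i q -> projective P -> inhabited (proj_resolution K n) ->
  inhabited (proj_resolution M n.+1).
Proof.
move=> [ii ex qs] hP [[obj d a hobj as_ e0 e len]].
pose obj' j := if j is j'.+1 then obj j' else P.
pose d' j : ghom (obj' j.+1) (obj' j) :=
  match j with 0 => gcomp i a | j'.+1 => d j' end.
constructor; apply: (@ProjRes G M n.+1 obj' d' q) => //.
- by case.
- move=> x; split=> [/ex[z <-]|[y <-]]; last by apply/ex; exists (a y).
  by have [y <-] := as_ z; exists y.
- case=> [|j] x //=; split=> [/ii/e0//|/e0 ->]; exact: raddf0.
- by case=> // j jn; exact: len.
Qed.

End Splicing.

Theorem theorem3p4 (pi : groupType) (n : nat) :
  cd_eq pi n -> cup_pow (berstein pi) n <> 0%R.
Proof.
case: n => [_|k [_ min_k] b0].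
  (* In degree 0 only the zero cochain is a coboundary, and b^0 is the cochain 1. *)
  rewrite cup_pow_berstein => b0.
  by have /(_ (fun=> 1%g)) := (@cclass_eq0P pi 0 _ _).1 b0.
apply: (min_k k (leqnn _)).
have [h [hE hb]] : exists h : cochain k (tpow (augI pi) k.+1),
    equivariant h /\ cobdry h =1 berstein_cocycle pi k.+1.
  by apply: (@cclass_eq0P pi k.+1 _ _).1; rewrite -cup_pow_berstein.
have [y|r rK] := @extension_of_cobdry pi k _ (ghom_id _) h hE.
  by rewrite -cext_cobdry /cext hb.
have projIk : projective (tpow (augI pi) k).
  exact: projective_quotient (short_exact_bres pi k) rK (@projective_bres pi k).
(* Splicing starts from the projective module I^k and goes down to I^0 = Z. *)
suff res j : (j <= k)%N -> inhabited (proj_resolution (tpow (augI pi) (k - j)) j).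
  by have := res k (leqnn k); rewrite subnn.
elim: j => [_|j IH jk]; first by rewrite subn0; exact: resolution_projective.
have := IH (ltnW jk); rewrite -subnSK //.
exact: resolution_splice (short_exact_bres pi _) (@projective_bres pi _).
Qed.
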